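(* Let $n,d,M\ge 1$ be integers and let $\rho>0$, $\epsilon>0$, $\tilde L>0$, $0<\beta\le \mathcal{B}$ be real parameters. For each node $i\in\{1,\dots,n\}$ let $\{x_i^k\}_{k\ge 0}$ and $\{g_i^k\}_{k\ge 0}$ be sequences in $\mathbb{R}^d$, and let the matrices $H_i^{k}$, $k\ge 1$, be constructed by the damped regularized limited-memory DFP method with memory size $M$ (as defined in the context). Then $$M_1 I_d\preceq H_i^{k}\preceq M_2 I_d,\qquad \forall\, i=1,\dots,n,\ \forall\, k\ge 1,$$ where $$M_1=\rho+(1+\omega)^{-2M}\left(\frac1\beta+\frac{1}{4(\mathcal{B}+\epsilon)}\right)^{-1},\qquad M_2=\mathcal{B}+M(4\mathcal{B}+4\epsilon+\rho),\qquad \omega=4(\mathcal{B}+\epsilon)\left(\tilde L+\frac{1}{\beta+\epsilon}\right).$$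
   Context: Notation: $\|\cdot\|$ is the Euclidean norm, $I_d$ the $d\times d$ identity, and $A\succeq B$ means $A-B$ is positive semidefinite. In the application, $x_i^k$ is the local decision variable and $g_i^k$ the local gradient approximation of node $i$ at time $k$; the construction below uses only these two sequences. Damped regularized limited-memory DFP at node $i$. For every $k\ge 0$ put $$s_i^k=x_i^{k+1}-x_i^k,\qquad y_i^k=g_i^{k+1}-g_i^k,\qquad \hat s_i^k=s_i^k-\rho\, y_i^k .$$ It is assumed that all quotients below are well defined, i.e. $\hat s_i^k\neq 0$ and $(s_i^k)^Ty_i^k\ne 0$ (hence $y_i^k\neq0$) for all $k$. Fix a time $k\ge 0$. Set $\tilde M=\min\{k+1,M\}$ and the initialization $$H_i^{k,(0)}=\min\left\{\max\left\{\frac{(s_i^k)^Ts_i^k}{(s_i^k)^Ty_i^k}+\rho,\ \beta\right\},\ \mathcal{B}\right\}I_d,$$ so that $\beta I_d\preceq H_i^{k,(0)}\preceq \mathcal{B}I_d$. For each $p\in\{k+1-\tilde M,\dots,k\}$ write $a_i^p=(\hat s_i^p)^T(H_i^{k,(0)}+\epsilon I_d)^{-1}\hat s_i^p$ and define $$\tilde\theta_i^p=\begin{cases}\dfrac{0.75\,a_i^p}{a_i^p-(\hat s_i^p)^Ty_i^p}, & \text{if } (\hat s_i^p)^Ty_i^p\le 0.25\,a_i^p,\\[2mm] 1,&\text{otherwise,}\end{cases}\qquad \theta_i^p=\min\left\{\tilde\theta_i^p,\ \frac{\tilde L\|\hat s_i^p\|}{\|y_i^p\|}\right\},$$ $$\hat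 y_i^p=\theta_i^p y_i^p+(1-\theta_i^p)(H_i^{k,(0)}+\epsilon I_d)^{-1}\hat s_i^p .$$ For $t=0,\dots,\tilde M-1$, with $p=k+1-\tilde M+t$, set $$H_i^{k,(t+1)}=H_i^{k,(t)}+\frac{\hat s_i^p(\hat s_i^p)^T}{(\hat s_i^p)^T\hat y_i^p}-\frac{H_i^{k,(t)}\hat y_i^p(\hat y_i^p)^TH_i^{k,(t)}}{(\hat y_i^p)^TH_i^{k,(t)}\hat y_i^p}+\rho I_d .$$ Finally $H_i^{k+1}=H_i^{k,(\tilde M)}$. *)

(* Defs.v *)
From mathcomp Require Import all_boot all_order all_algebra.
From mathcomp Require Import reals.

Set Implicit Arguments.
Unset Strict Implicit.
Unset Printing Implicit Defensive.

Import Order.TTheory GRing.Theory Num.Theory.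

Local Open Scope ring_scope.

Definition dotv (R : realType) (d : nat) (u v : 'cV[R]_d) : R :=
  (u^T *m v) 0 0.

(* The Euclidean norm, as opposed to the max norm that MathComp-Analysis puts
   on matrices. *)
Definition enorm (R : realType) (d : nat) (u : 'cV[R]_d) : R :=
  Num.sqrt (dotv u u).

Definition psd (R : realType) (d : nat) (A : 'M[R]_d) : Prop :=
  A^T = A /\ forall v : 'cV[R]_d, 0 <= dotv v (A *m v).

Definition loewner_le (R : realType) (d : nat) (A B : 'M[R]_d) : Prop :=
  psd (B - A).

Notation "A ⪯ B" := (loewner_le A B) (at level 70, no associativity)
  : ring_scope.

(* Damped regularized limited-memory DFP at a single node, driven by the
   iterates [x] and the gradient approximations [g] of that node. *)
Section DampedDFP.

Variables (R : realType) (d : nat).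
Variables (M : nat) (rho eps Lt beta B : R).
Variables (x g : nat -> 'cV[R]_d).

Definition dfp_s (k : nat) : 'cV[R]_d := x k.+1 - x k.

Definition dfp_y (k : nat) : 'cV[R]_d := g k.+1 - g k.

Definition dfp_shat (k : nat) : 'cV[R]_d := dfp_s k - rho *: dfp_y k.

Definition dfp_H0 (k : nat) : 'M[R]_d :=
  (Num.min
     (Num.max (dotv (dfp_s k) (dfp_s k) / dotv (dfp_s k) (dfp_y k) + rho) beta)
     B)%:M.

(* Below, [k] is the time at which the matrix is built and [p] the time of the
   stored pair that is being damped. *)
Definition dfp_Hinv_shat (k p : nat) : 'cV[R]_d :=
  invmx (dfp_H0 k + eps%:M) *m dfp_shat p.

Definition dfp_a (k p : nat) : R :=
  dotv (dfp_shat p) (dfp_Hinv_shat k p).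

Definition dfp_theta_tilde (k p : nat) : R :=
  if dotv (dfp_shat p) (dfp_y p) <= 1 / 4 * dfp_a k p
  then 3 / 4 * dfp_a k p / (dfp_a k p - dotv (dfp_shat p) (dfp_y p))
  else 1.

Definition dfp_theta (k p : nat) : R :=
  Num.min (dfp_theta_tilde k p) (Lt * enorm (dfp_shat p) / enorm (dfp_y p)).

Definition dfp_yhat (k p : nat) : 'cV[R]_d :=
  dfp_theta k p *: dfp_y p + (1 - dfp_theta k p) *: dfp_Hinv_shat k p.

Definition dfp_step (H : 'M[R]_d) (s y : 'cV[R]_d) : 'M[R]_d :=
  H + (dotv s y)^-1 *: (s *m s^T)
    - (dotv y (H *m y))^-1 *: (H *m y *m y^T *m H)
    + rho%:M.

Definition dfp_mem (k : nat) : nat := minn k.+1 M.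

Fixpoint dfp_inner (k t : nat) : 'M[R]_d :=
  if t is t'.+1 then
    let p := (k.+1 - dfp_mem k + t')%N in
    dfp_step (dfp_inner k t') (dfp_shat p) (dfp_yhat k p)
  else dfp_H0 k.

(* The matrix built at time [k], which carries the index [k + 1]. *)
Definition dfp_next (k : nat) : 'M[R]_d := dfp_inner k (dfp_mem k).

End DampedDFP.

(* Main.v *)
Require Import Defs.
From mathcomp Require Import all_boot all_order all_algebra.
From mathcomp Require Import reals.
From mathcomp Require Import ring lra.

(** Write s, y for a stored pair after damping.  Damping bounds the curvature
    s.y from below and the length of y from above in terms of s:
      |s|^2 <= 4 (B + eps) s.y   and   |y| <= (Lt + 1 / (beta + eps)) |s|.
    Consequently |s| |y| <= omega s.y and |y|^2 <= omega^2 kappa s.y, where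
    kappa = 1 / (4 (B + eps)).

    Upper bound.  An update adds s s^T / s.y, which is at most 4 (B + eps) I by
    Cauchy-Schwarz, subtracts a positive semidefinite matrix, and adds rho I;
    at most M updates are applied to a matrix below B I ([dfp_inner_le]).

    Lower bound.  On inverses, and before rho I is added, the DFP update reads
      (I - y s^T / s.y) H^-1 (I - s y^T / s.y) + y y^T / s.y,
    so an upper bound u on H^-1 becomes (1 + omega)^2 u + omega^2 kappa.
    [dfp_step_ge] proves this as a statement on the quadratic form of H, without
    inverting any matrix.  The sequence
      u_t = (1 + omega)^(2 t) (1 / beta + kappa) - kappa
    starts at 1 / beta and absorbs this recursion ([inv_boundS]), hence
    H^(t) >= 1 / u_t for each inner iterate.  The term rho I of the earlier
    updates is dropped; that of the last one is kept and gives the summand rho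
    of the bound ([dfp_next_ge]). *)

Set Implicit Arguments.
Unset Strict Implicit.
Unset Printing Implicit Defensive.

Import Order.TTheory GRing.Theory Num.Theory.

Local Open Scope ring_scope.

(** * The Euclidean inner product *)

Section InnerProduct.

Variables (R : realType) (d : nat).
Implicit Types (u v w : 'cV[R]_d) (A : 'M[R]_d) (a c : R).

Lemma dotvE u v : dotv u v = \sum_i u i 0 * v i 0.
Proof. by rewrite /dotv mxE; apply: eq_bigr => i _; rewrite mxE. Qed.

Lemma dotvC u v : dotv u v = dotv v u.
Proof. by rewrite !dotvE; apply: eq_bigr => i _; rewrite mulrC. Qed.

Lemma dotvDr u v w : dotv u (v + w) = dotv u v + dotv u w.
Proof. by rewrite /dotv mulmxDr mxE. Qed.

Lemma dotvZr a u v : dotv u (a *: v) = a * dotv u v.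
Proof. by rewrite /dotv -scalemxAr mxE. Qed.

Lemma dotvBr u v w : dotv u (v - w) = dotv u v - dotv u w.
Proof. by rewrite -scaleN1r dotvDr dotvZr mulN1r. Qed.

Lemma dotvDl u v w : dotv (u + v) w = dotv u w + dotv v w.
Proof. by rewrite !(dotvC _ w) dotvDr. Qed.

Lemma dotvZl a u v : dotv (a *: u) v = a * dotv u v.
Proof. by rewrite !(dotvC _ v) dotvZr. Qed.

Lemma dotvBl u v w : dotv (u - v) w = dotv u w - dotv v w.
Proof. by rewrite !(dotvC _ w) dotvBr. Qed.

Lemma dotv0l u : dotv 0 u = 0.
Proof. by rewrite -(scale0r 0) dotvZl mul0r. Qed.

Lemma dotv_mulmx_sym A u v : A^T = A -> dotv u (A *m v) = dotv v (A *m u).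
Proof. by move=> Asym; rewrite dotvC /dotv trmx_mul Asym mulmxA. Qed.

Lemma mulmx_outer u w v : u *m w^T *m v = dotv w v *: u.
Proof. by rewrite -mulmxA [w^T *m v]mx11_scalar mul_mx_scalar. Qed.

Lemma dotv_ge0 u : 0 <= dotv u u.
Proof. by rewrite dotvE; apply: sumr_ge0 => i _; rewrite -expr2 sqr_ge0. Qed.

Lemma dotv_gt0 u : u != 0 -> 0 < dotv u u.
Proof.
move=> u_neq0; rewrite lt_def dotv_ge0 andbT; apply: contraNneq u_neq0.
rewrite dotvE => /eqP; rewrite psumr_eq0 => [/allP u0|i _]; last first.
  by rewrite -expr2 sqr_ge0.
apply/eqP/matrixP => i j; rewrite ord1 !mxE; apply/eqP.
by have := u0 i (mem_index_enum i); rewrite /= mulf_eq0 orbb.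
Qed.

Lemma enorm_ge0 u : 0 <= enorm u.
Proof. exact: sqrtr_ge0. Qed.

Lemma sqr_enorm u : enorm u ^+ 2 = dotv u u.
Proof. by rewrite sqr_sqrtr ?dotv_ge0. Qed.

(** The squared length of |v|^2 u - (u.v) v is |v|^2 times the defect of the
    inequality. *)
Lemma cauchy_schwarz u v : dotv u v ^+ 2 <= dotv u u * dotv v v.
Proof.
have [->|v_neq0] := eqVneq v 0.
  by rewrite dotvC !dotv0l expr0n mulr0.
have vv_gt0 := dotv_gt0 v_neq0.
have := dotv_ge0 (dotv v v *: u - dotv u v *: v).
rewrite !dotvBl !dotvBr !dotvZl !dotvZr (dotvC v u) => defect_ge0.
have : 0 <= dotv v v * (dotv u u * dotv v v - dotv u v ^+ 2) by nra.
by rewrite pmulr_rge0 // subr_ge0.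
Qed.

Lemma normr_dotv_le u v : `|dotv u v| <= enorm u * enorm v.
Proof.
rewrite -(@ler_pXn2r _ 2) ?nnegrE ?mulr_ge0 ?enorm_ge0 //.
by rewrite real_normK ?num_real // exprMn !sqr_enorm cauchy_schwarz.
Qed.

Lemma enormD u v : enorm (u + v) <= enorm u + enorm v.
Proof.
rewrite -(@ler_pXn2r _ 2) ?nnegrE ?addr_ge0 ?enorm_ge0 //.
rewrite sqr_enorm dotvDl !dotvDr (dotvC v u) sqrrD !sqr_enorm.
have := le_trans (ler_norm _) (normr_dotv_le u v); lra.
Qed.

Lemma enormZ a u : enorm (a *: u) = `|a| * enorm u.
Proof.
by rewrite /enorm dotvZl dotvZr mulrA -expr2 sqrtrM ?sqr_ge0 // sqrtr_sqr.
Qed.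

Lemma dotv_scalar c v : dotv v (c%:M *m v) = c * dotv v v.
Proof. by rewrite mul_scalar_mx dotvZr. Qed.

Lemma scalar_loewner c A :
  A^T = A -> (forall v, c * dotv v v <= dotv v (A *m v)) -> c%:M ⪯ A.
Proof.
move=> Asym Age; split=> [|v]; first by rewrite linearB /= tr_scalar_mx Asym.
by rewrite mulmxBl dotvBr dotv_scalar subr_ge0.
Qed.

Lemma loewner_scalar c A :
  A^T = A -> (forall v, dotv v (A *m v) <= c * dotv v v) -> A ⪯ c%:M.
Proof.
move=> Asym Ale; split=> [|v]; first by rewrite linearB /= tr_scalar_mx Asym.
by rewrite mulmxBl dotvBr dotv_scalar subr_ge0.
Qed.

End InnerProduct.

(** * One regularized DFP update *)

Section Update.

Variables (R : realType) (d : nat) (rho : R) (H : 'M[R]_d) (s y : 'cV[R]_d).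
Hypothesis Hsym : H^T = H.

Lemma dfp_step_sym : (dfp_step rho H s y)^T = dfp_step rho H s y.
Proof.
rewrite /dfp_step !linearD linearN /= !linearZ /= tr_scalar_mx.
by rewrite !trmx_mul !trmxK Hsym !mulmxA.
Qed.

Lemma dotv_dfp_step v :
  dotv v (dfp_step rho H s y *m v) =
    dotv v (H *m v) + dotv s v ^+ 2 / dotv s y
    - dotv y (H *m v) ^+ 2 / dotv y (H *m y) + rho * dotv v v.
Proof.
rewrite /dfp_step !mulmxDl mulNmx -!scalemxAl !dotvDr -scaleN1r !dotvZr.
rewrite mulmx_outer dotvZr dotv_scalar -!mulmxA (mulmxA y^T).
rewrite [y^T *m H *m v]mx11_scalar mul_mx_scalar -scalemxAr dotvZr.
rewrite -[y^T *m H *m v]mulmxA -/(dotv y (H *m v)).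
rewrite (dotv_mulmx_sym v y Hsym) (dotvC v s); ring.
Qed.

(** The subtracted rank-one term has a nonnegative quadratic form, and
    Cauchy-Schwarz bounds (s.v)^2 / s.y by C |v|^2. *)
Lemma dfp_step_le (b C : R) :
    (forall v, 0 <= dotv v (H *m v) <= b * dotv v v) ->
    0 < dotv s y -> dotv s s <= C * dotv s y ->
  forall v, dotv v (dfp_step rho H s y *m v) <= (b + C + rho) * dotv v v.
Proof.
move=> Hle sy_gt0 ss_le v; rewrite dotv_dfp_step.
have /andP[_ vHv_le] := Hle v; have /andP[yHy_ge0 _] := Hle y.
have : 0 <= dotv y (H *m v) ^+ 2 / dotv y (H *m y).
  by rewrite divr_ge0 ?sqr_ge0.
have : dotv s v ^+ 2 / dotv s y <= C * dotv v v.
  rewrite ler_pdivrMr //; apply: le_trans (cauchy_schwarz s v) _.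
  by rewrite mulrAC ler_wpM2r ?dotv_ge0.
lra.
Qed.

(** The form of H minus its rank-one correction at v is the minimum over tau
    of the form of H at v - tau y, hence at least |w|^2 / u for the minimizing
    w = v - tau y.  Eliminating tau through s.v gives
      v = w + ((s.v - s.w) / s.y) y,
    so |v| <= (1 + om) |w| + |s.v| |y| / s.y.  Cauchy-Schwarz in the plane, with
    weights u and s.y, compares |v|^2 with |w|^2 / u + (s.v)^2 / s.y, the lower
    bound obtained for the updated form. *)
Lemma dfp_step_ge (u K om : R) :
    0 < u -> 0 <= K -> 0 <= om ->
    (forall v, u^-1 * dotv v v <= dotv v (H *m v)) ->
    0 < dotv s y -> enorm s * enorm y <= om * dotv s y ->
    dotv y y <= K * dotv s y ->
  forall v, (rho + ((1 + om) ^+ 2 * u + K)^-1) * dotv v v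
              <= dotv v (dfp_step rho H s y *m v).
Proof.
move=> u_gt0 K_ge0 om_ge0 Hge sy_gt0 angle yy_le v.
have y_neq0 : y != 0.
  by apply: contraTneq sy_gt0 => ->; rewrite dotvC dotv0l ltxx.
have yHy_gt0 : 0 < dotv y (H *m y).
  by apply: lt_le_trans (Hge y); rewrite mulr_gt0 ?invr_gt0 ?dotv_gt0.
have yHy_neq0 := lt0r_neq0 yHy_gt0.
have sy_neq0 := lt0r_neq0 sy_gt0.
rewrite dotv_dfp_step.
pose tau := dotv y (H *m v) / dotv y (H *m y).
pose w := v - tau *: y.
have wHw : dotv w (H *m w)
    = dotv v (H *m v) - dotv y (H *m v) ^+ 2 / dotv y (H *m y).
  rewrite /w mulmxBr -scalemxAr !dotvBl !dotvBr !dotvZl !dotvZr.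
  by rewrite (dotv_mulmx_sym v y Hsym) /tau; field.
have wHw_ge := Hge w.
have vE : v = w + ((dotv s v - dotv s w) / dotv s y) *: y.
  rewrite {2}/w dotvBr dotvZr.
  have -> : (dotv s v - (dotv s v - tau * dotv s y)) / dotv s y = tau.
    by field.
  by rewrite subrK.
set z := dotv s v in vE *; set q := dotv s y in sy_gt0 sy_neq0 angle yy_le vE *.
have v_le : enorm v <= (1 + om) * enorm w + `|z| * enorm y / q.
  rewrite {1}vE; apply: le_trans (enormD _ _) _.
  rewrite enormZ normrM normfV (gtr0_norm sy_gt0) mulrDl mul1r -addrA lerD2l.
  have sw_le : `|dotv s w| * enorm y / q <= om * enorm w.
    rewrite ler_pdivrMr //.
    apply: le_trans (ler_wpM2r (enorm_ge0 y) (normr_dotv_le s w)) _.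
    by rewrite mulrAC [leRHS]mulrAC ler_wpM2r ?enorm_ge0.
  apply: le_trans (_ : (`|z| + `|dotv s w|) * enorm y / q <= _).
    rewrite mulrAC; apply: ler_wpM2r; first by rewrite invr_ge0 ltW.
    by apply: ler_wpM2r (enorm_ge0 y) _ _ (ler_normB _ _).
  by rewrite !mulrDl [leRHS]addrC lerD2l.
pose D := (1 + om) ^+ 2 * u + K.
have D_gt0 : 0 < D.
  by rewrite /D ltr_wpDr // mulr_gt0 // exprn_gt0 // ltr_wpDr.
pose E := u^-1 * dotv w w + z ^+ 2 / q.
have E_ge0 : 0 <= E.
  apply: addr_ge0; last by rewrite divr_ge0 ?sqr_ge0 // ltW.
  by rewrite mulr_ge0 ?dotv_ge0 // invr_ge0 ltW.
have vv_le : dotv v v <= D * E.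
  rewrite -sqr_enorm.
  have : enorm v ^+ 2 <= ((1 + om) * enorm w + `|z| * enorm y / q) ^+ 2.
    rewrite ler_pXn2r ?nnegrE ?enorm_ge0 //.
    exact: le_trans (enorm_ge0 v) v_le.
  move=> /le_trans; apply.
  apply: le_trans (_ : ((1 + om) ^+ 2 * u + dotv y y / q) * E <= _).
    (* The defect of this planar Cauchy-Schwarz inequality is a square. *)
    rewrite /E -(sqr_enorm w) -(sqr_enorm y).
    rewrite -[z ^+ 2](real_normK (num_real z)) -subr_ge0.
    have -> : ((1 + om) ^+ 2 * u + enorm y ^+ 2 / q)
               * (u^-1 * enorm w ^+ 2 + `|z| ^+ 2 / q)
             - ((1 + om) * enorm w + `|z| * enorm y / q) ^+ 2
             = ((1 + om) * u * `|z| - enorm w * enorm y) ^+ 2 / (u * q).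
      by field; rewrite sy_neq0 lt0r_neq0.
    by rewrite divr_ge0 ?sqr_ge0 // mulr_ge0 // ltW.
  by rewrite ler_wpM2r // lerD2l ler_pdivrMr.
have : D^-1 * dotv v v <= E by rewrite ler_pdivrMl.
rewrite /E -/D; lra.
Qed.

End Update.

(** * The damped pair *)

Section Damping.

Variables (R : realType) (d : nat) (rho eps Lt beta B : R).
Variables (x g : nat -> 'cV[R]_d).
Hypotheses (eps_gt0 : 0 < eps) (Lt_gt0 : 0 < Lt).
Hypotheses (beta_gt0 : 0 < beta) (beta_le_B : beta <= B).

Let beta_eps_gt0 : 0 < beta + eps.
Proof. exact: addr_gt0. Qed.

Let B_eps_gt0 : 0 < B + eps.
Proof. by apply: addr_gt0 => //; apply: lt_le_trans beta_le_B. Qed.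

Lemma dfp_H0_scalar k :
  exists2 h : R, beta <= h <= B & dfp_H0 rho beta B x g k = h%:M.
Proof.
eexists; last by [].
by rewrite le_min ge_min le_max !lexx !orbT beta_le_B.
Qed.

Variables (k p : nat).
Local Notation s := (dfp_shat rho x g p).
Local Notation y := (dfp_y g p).
Local Notation yhat := (dfp_yhat rho eps Lt beta B x g k p).
Local Notation a := (dfp_a rho eps beta B x g k p).
Local Notation theta_tilde := (dfp_theta_tilde rho eps beta B x g k p).
Local Notation theta := (dfp_theta rho eps Lt beta B x g k p).

Lemma dfp_Hinv_shat_scalar :
  exists2 c : R, beta + eps <= c <= B + eps
    & dfp_Hinv_shat rho eps beta B x g k p = c^-1 *: s.
Proof.
have [h /andP[h_ge h_le] H0E] := dfp_H0_scalar k.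
exists (h + eps); first by rewrite !lerD2r h_ge.
by rewrite /dfp_Hinv_shat H0E -raddfD /= invmx_scalar mul_scalar_mx.
Qed.

Hypothesis shat_neq0 : s != 0.

Lemma dfp_a_ge : dotv s s <= (B + eps) * a.
Proof.
rewrite /dfp_a; have [c /andP[c_ge c_le] ->] := dfp_Hinv_shat_scalar.
have c_gt0 : 0 < c by apply: lt_le_trans c_ge.
rewrite dotvZr mulrA ler_peMl ?dotv_ge0 //.
by rewrite ler_pdivlMr ?mul1r.
Qed.

Lemma dfp_a_gt0 : 0 < a.
Proof.
have ss_gt0 := dotv_gt0 shat_neq0.
by rewrite -(pmulr_rgt0 _ B_eps_gt0); apply: lt_le_trans ss_gt0 dfp_a_ge.
Qed.

(** In the damped case s.y <= a / 4, the denominator a - s.y is at least the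
    numerator 3 a / 4. *)
Lemma dfp_theta_tilde_ge0_le1 : 0 <= theta_tilde <= 1.
Proof.
rewrite /dfp_theta_tilde; have a_gt0 := dfp_a_gt0.
case: ifP => [sy_le|_]; last by rewrite ler01 lexx.
have den_gt0 : 0 < a - dotv s y by lra.
have num_ge0 : 0 <= 3 / 4 * a by lra.
by rewrite divr_ge0 ?(ltW den_gt0) //= ler_pdivrMr //; lra.
Qed.

Lemma dfp_theta_ge0_le1 : 0 <= theta <= 1.
Proof.
have /andP[t_ge0 t_le1] := dfp_theta_tilde_ge0_le1.
rewrite /dfp_theta le_min t_ge0 ge_min t_le1 /= andbT.
by rewrite divr_ge0 ?mulr_ge0 ?enorm_ge0 // ltW.
Qed.

(** Damping mixes the curvature s.y with the curvature a of the initial matrix: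
    s.yhat = a - theta (a - s.y).  In the damped case, theta_tilde is the weight
    at which this mixture equals a / 4, and a smaller weight only increases it;
    otherwise both curvatures are at least a / 4. *)
Lemma dfp_yhat_curvature : a <= 4 * dotv s yhat.
Proof.
rewrite /dfp_yhat dotvDr !dotvZr -/(dfp_a rho eps beta B x g k p).
have a_gt0 := dfp_a_gt0.
have /andP[t_ge0 t_le1] := dfp_theta_ge0_le1.
have : theta <= theta_tilde by rewrite ge_min lexx.
rewrite /dfp_theta_tilde; case: ifP => [sy_le|/negbT]; last first.
  by rewrite -ltNge => sy_gt _; nra.
have den_gt0 : 0 < a - dotv s y by lra.
by rewrite ler_pdivlMr //; lra.
Qed.

Lemma dfp_yhat_dotv_le : dotv s s <= 4 * (B + eps) * dotv s yhat.
Proof.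
apply: le_trans dfp_a_ge _; rewrite (mulrC 4) -mulrA.
by rewrite ler_wpM2l ?dfp_yhat_curvature // ltW.
Qed.

Lemma dfp_yhat_dotv_gt0 : 0 < dotv s yhat.
Proof. by have := dfp_a_gt0; have := dfp_yhat_curvature; lra. Qed.

(** The cap on theta controls the component along y, whose length may be
    arbitrarily large compared with that of s; the other component is s / c for
    some c >= beta + eps. *)
Lemma enorm_dfp_yhat_le : enorm yhat <= (Lt + 1 / (beta + eps)) * enorm s.
Proof.
have /andP[t_ge0 t_le1] := dfp_theta_ge0_le1.
rewrite /dfp_yhat; apply: le_trans (enormD _ _) _; rewrite mulrDl.
rewrite !enormZ (ger0_norm t_ge0) ger0_norm ?subr_ge0 //.
apply: lerD.
  have [->|y_neq0] := eqVneq (enorm y) 0.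
    by rewrite mulr0 mulr_ge0 ?enorm_ge0 // ltW.
  by rewrite -ler_pdivlMr ?lt_def ?y_neq0 ?enorm_ge0 // ge_min lexx orbT.
have [c /andP[c_ge c_le] ->] := dfp_Hinv_shat_scalar.
have c_gt0 : 0 < c by apply: lt_le_trans c_ge.
rewrite enormZ ger0_norm ?invr_ge0 ?(ltW c_gt0) // mulrA.
apply: ler_wpM2r; first exact: enorm_ge0.
apply: ler_pM; rewrite ?subr_ge0 ?invr_ge0 ?(ltW c_gt0) //.
  by rewrite gerBl.
by rewrite lef_pV2 ?posrE.
Qed.

Let omega := 4 * (B + eps) * (Lt + 1 / (beta + eps)).
Let kappa := 1 / (4 * (B + eps)).

Lemma dfp_yhat_angle : enorm s * enorm yhat <= omega * dotv s yhat.
Proof.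
have lam_ge0 : 0 <= Lt + 1 / (beta + eps).
  by rewrite addr_ge0 ?divr_ge0 // ltW.
apply: le_trans (ler_wpM2l (enorm_ge0 s) enorm_dfp_yhat_le) _.
rewrite mulrCA -expr2 sqr_enorm /omega mulrAC mulrC.
exact: ler_wpM2r lam_ge0 _ _ dfp_yhat_dotv_le.
Qed.

Lemma sqr_dfp_yhat_le :
  dotv yhat yhat <= omega ^+ 2 * kappa * dotv s yhat.
Proof.
set lam := Lt + 1 / (beta + eps).
have lam_ge0 : 0 <= lam by rewrite addr_ge0 ?divr_ge0 // ltW.
have -> : omega ^+ 2 * kappa * dotv s yhat
          = lam ^+ 2 * (4 * (B + eps) * dotv s yhat).
  by rewrite /omega /kappa -/lam; field; exact: lt0r_neq0.
apply: le_trans (_ : lam ^+ 2 * dotv s s <= _); last first.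
  by rewrite ler_wpM2l ?sqr_ge0 ?dfp_yhat_dotv_le.
rewrite -!sqr_enorm -exprMn ler_pXn2r ?nnegrE ?mulr_ge0 ?enorm_ge0 //.
exact: enorm_dfp_yhat_le.
Qed.

End Damping.

(** * Accumulation over the memory window *)

Section Window.

Variables (R : realType) (d M : nat) (rho eps Lt beta B : R).
Variables (x g : nat -> 'cV[R]_d).
Hypotheses (rho_gt0 : 0 < rho) (eps_gt0 : 0 < eps) (Lt_gt0 : 0 < Lt).
Hypotheses (beta_gt0 : 0 < beta) (beta_le_B : beta <= B).
Hypothesis shat_neq0 : forall k, dfp_shat rho x g k != 0.

Let omega := 4 * (B + eps) * (Lt + 1 / (beta + eps)).
Let kappa := 1 / (4 * (B + eps)).
(** Bound on the inverse of the inner iterate [t].  Shifted by kappa, the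
    affine recursion of [dfp_step_ge] is dominated by a geometric one. *)
Let u t := (1 + omega) ^+ (2 * t) * (1 / beta + kappa) - kappa.
Local Notation Hin := (dfp_inner M rho eps Lt beta B x g).

Let B_eps4_gt0 : 0 < 4 * (B + eps).
Proof.
by apply: mulr_gt0 => //; apply: addr_gt0 => //; apply: lt_le_trans beta_le_B.
Qed.

Let omega_gt0 : 0 < omega.
Proof.
rewrite /omega; apply: mulr_gt0 => //.
by rewrite ltr_wpDr // divr_ge0 // ltW // addr_gt0.
Qed.

Let kappa_gt0 : 0 < kappa.
Proof. by rewrite /kappa divr_gt0. Qed.

Lemma dfp_inner_sym k t : (Hin k t)^T = Hin k t.
Proof.
by elim: t => [|t IHt] /=; [rewrite /dfp_H0 tr_scalar_mx | exact: dfp_step_sym].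
Qed.

Lemma omega_pow_ge1 t : 1 <= (1 + omega) ^+ (2 * t).
Proof. by rewrite exprn_ege1 // lerDl ltW. Qed.

Lemma inv_bound_gt0 t : 0 < u t.
Proof.
have beta_inv_gt0 : 0 < 1 / beta by rewrite divr_gt0.
rewrite /u subr_gt0; apply: (@lt_le_trans _ _ (1 / beta + kappa)).
  by rewrite ltrDr.
by rewrite ler_peMl ?omega_pow_ge1 // ltW // addr_gt0.
Qed.

(** The two sides differ by 2 omega kappa, since
    (1 + omega)^2 - omega^2 - 1 = 2 omega. *)
Lemma inv_boundS t : (1 + omega) ^+ 2 * u t + omega ^+ 2 * kappa <= u t.+1.
Proof.
rewrite /u mulnS exprD -subr_ge0.
have -> : forall P : R, (1 + omega) ^+ 2 * P * (1 / beta + kappa) - kappa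
   - ((1 + omega) ^+ 2 * (P * (1 / beta + kappa) - kappa) + omega ^+ 2 * kappa)
   = 2 * omega * kappa by move=> P; ring.
by apply/ltW/mulr_gt0 => //; apply: mulr_gt0.
Qed.

(** The summand rho is kept because the final bound retains that of the last
    update, whereas the induction over the window discards it. *)
Lemma dfp_inner_succ_ge k t :
    (forall v, (u t)^-1 * dotv v v <= dotv v (Hin k t *m v)) ->
  forall v, (rho + (u t.+1)^-1) * dotv v v <= dotv v (Hin k t.+1 *m v).
Proof.
move=> IH v /=; set p := (k.+1 - _ + t)%N.
have K_ge0 : 0 <= omega ^+ 2 * kappa by rewrite mulr_ge0 ?sqr_ge0 // ltW.
have ut_gt0 := inv_bound_gt0 t.
apply: le_trans (dfp_step_ge rho (dfp_inner_sym k t) ut_gt0 K_ge0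
  (ltW omega_gt0) IH
  (dfp_yhat_dotv_gt0 eps_gt0 Lt_gt0 beta_gt0 beta_le_B k (shat_neq0 p))
  (dfp_yhat_angle eps_gt0 Lt_gt0 beta_gt0 beta_le_B k (shat_neq0 p))
  (sqr_dfp_yhat_le eps_gt0 Lt_gt0 beta_gt0 beta_le_B k (shat_neq0 p)) v).
rewrite ler_wpM2r ?dotv_ge0 // lerD2l lef_pV2 ?posrE ?inv_bound_gt0 //.
  exact: inv_boundS.
by rewrite ltr_wpDr // mulr_gt0 // exprn_gt0 // addr_gt0.
Qed.

Lemma dfp_inner_ge k t v : (u t)^-1 * dotv v v <= dotv v (Hin k t *m v).
Proof.
elim: t v => [|t IHt] v.
  rewrite /u /= muln0 expr0 mul1r addrK div1r invrK.
  have [h /andP[h_ge _] ->] := dfp_H0_scalar rho x g beta_le_B k.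
  by rewrite dotv_scalar ler_wpM2r ?dotv_ge0.
apply: le_trans (dfp_inner_succ_ge IHt v).
by rewrite ler_wpM2r ?dotv_ge0 // lerDr ltW.
Qed.

Lemma dfp_inner_le k t v :
  dotv v (Hin k t *m v) <= (B + t%:R * (4 * B + 4 * eps + rho)) * dotv v v.
Proof.
elim: t v => [|t IHt] v.
  have [h /andP[_ h_le] /= ->] := dfp_H0_scalar rho x g beta_le_B k.
  by rewrite dotv_scalar mul0r addr0 ler_wpM2r ?dotv_ge0.
rewrite /=; set p := (k.+1 - _ + t)%N.
have bnd w : 0 <= dotv w (Hin k t *m w)
    <= (B + t%:R * (4 * B + 4 * eps + rho)) * dotv w w.
  rewrite IHt andbT; apply: le_trans (dfp_inner_ge k t w).
  by rewrite mulr_ge0 ?dotv_ge0 // invr_ge0 ltW ?inv_bound_gt0.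
apply: le_trans (dfp_step_le rho (dfp_inner_sym k t) bnd
  (dfp_yhat_dotv_gt0 eps_gt0 Lt_gt0 beta_gt0 beta_le_B k (shat_neq0 p))
  (dfp_yhat_dotv_le eps_gt0 Lt_gt0 beta_gt0 beta_le_B k (shat_neq0 p)) v) _.
by rewrite le_eqVlt -natr1; apply/orP; left; apply/eqP; ring.
Qed.

Lemma dfp_next_le k :
  dfp_next M rho eps Lt beta B x g k
    ⪯ (B + M%:R * (4 * B + 4 * eps + rho))%:M.
Proof.
apply: loewner_scalar => [|v]; first exact: dfp_inner_sym.
apply: le_trans (dfp_inner_le _ _ _) _.
have gain_ge0 : 0 <= 4 * B + 4 * eps + rho.
  by rewrite -mulrDr addr_ge0 // ltW.
by rewrite ler_wpM2r ?dotv_ge0 // lerD2l ler_wpM2r ?ler_nat ?geq_minr.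
Qed.

Lemma dfp_next_ge k : (1 <= M)%N ->
  (rho + (1 + omega) ^- (2 * M) * (1 / beta + kappa)^-1)%:M
    ⪯ dfp_next M rho eps Lt beta B x g k.
Proof.
move=> M_ge1; apply: scalar_loewner => [|v]; first exact: dfp_inner_sym.
(* The window is nonempty, so a last update can be singled out. *)
have mem_gt0 : (0 < dfp_mem M k)%N by rewrite leq_min M_ge1.
rewrite /dfp_next -(prednK mem_gt0).
apply: le_trans (dfp_inner_succ_ge (@dfp_inner_ge k _) v).
rewrite ler_wpM2r ?dotv_ge0 // lerD2l prednK // -invfM.
have c_gt0 : 0 < 1 / beta + kappa by rewrite addr_gt0 // divr_gt0.
have pow_gt0 n : 0 < (1 + omega) ^+ n by rewrite exprn_gt0 // addr_gt0.
rewrite lef_pV2 ?posrE ?mulr_gt0 ?inv_bound_gt0 //.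
apply: le_trans (_ : (1 + omega) ^+ (2 * dfp_mem M k) * (1 / beta + kappa)
                     <= _).
  by rewrite lerBlDr lerDl ltW.
rewrite ler_wpM2r ?(ltW c_gt0) // ler_weXn2l ?lerDl ?(ltW omega_gt0) //.
by rewrite leq_mul2l geq_minr.
Qed.

End Window.

Theorem theorem1 (R : realType) (n d M : nat) (rho eps Lt beta B : R)
    (x g : 'I_n -> nat -> 'cV[R]_d) (H : 'I_n -> nat -> 'M[R]_d)
    (n_ge1 : (1 <= n)%N) (d_ge1 : (1 <= d)%N) (M_ge1 : (1 <= M)%N)
    (rho_gt0 : 0 < rho) (eps_gt0 : 0 < eps) (Lt_gt0 : 0 < Lt)
    (beta_gt0 : 0 < beta) (beta_le_B : beta <= B)
    (shat_neq0 : forall i k, dfp_shat rho (x i) (g i) k != 0)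
    (sy_neq0 : forall i k, dotv (dfp_s (x i) k) (dfp_y (g i) k) != 0)
    (H_dfp : forall i k,
      H i k.+1 = dfp_next M rho eps Lt beta B (x i) (g i) k) :
  let omega := 4 * (B + eps) * (Lt + 1 / (beta + eps)) in
  let M1 := rho
    + (1 + omega) ^- (2 * M)%N * (1 / beta + 1 / (4 * (B + eps)))^-1 in
  let M2 := B + M%:R * (4 * B + 4 * eps + rho) in
  forall (i : 'I_n) (k : nat), (1 <= k)%N -> M1%:M ⪯ H i k /\ H i k ⪯ M2%:M.
Proof.
move=> omega M1 M2 i [//|k] _; rewrite H_dfp.
by split; [exact: dfp_next_ge | exact: dfp_next_le].
Qed.
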